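(* Let $N\ge 1$, $n_u,n_x\ge 1$ and $c_0,\dots,c_N\ge 0$ be integers. Let $H^l_j\in\mathbb{R}^{(n_u+n_x)\times(n_u+n_x)}$ ($0\le j\le N-1$) and $Q_N\in\mathbb{R}^{n_x\times n_x}$ be symmetric, let $F_j\in\mathbb{R}^{n_x\times(n_u+n_x)}$ and $G_j\in\mathbb{R}^{c_j\times(n_u+n_x)}$ ($0\le j\le N-1$), and let $G_N\in\mathbb{R}^{c_N\times n_x}$. Let $\Sigma_j,\tilde\Sigma_j\in\mathbb{R}^{c_j\times c_j}$ ($0\le j\le N$) be diagonal matrices with nonnegative diagonal entries. Assume that the Riccati factorization procedure (defined in the context) is well-defined both for the penalties $\{\Sigma_j\}_{j=0}^N$ and for the penalties $\{\tilde\Sigma_j\}_{j=0}^N$, i.e. in both cases every matrix whose Cholesky factor it computes is positive definite. Let $\{L_{uu,j}\}_{j=0}^{N-1}$, $\{L_{xu,j}\}_{j=0}^{N-1}$, $\{L_{xx,j}\}_{j=0}^{N}$ be the output of the Riccati factorization procedure for the penalties $\{\Sigma_j\}_{j=0}^N$. Then the Riccati factorization update procedure (defined in the context), applied to $\{F_j\}$, $\{G_j\}$, $\{\Sigma_j\}$, $\{\tilde\Sigma_j\}$ and these factors, outputs matrices $\{\tilde L_{uu,j}\}_{j=0}^{N-1}$, $\{\tilde L_{xu,j}\}_{j=0}^{N-1}$, $\{\tilde L_{xx,j}\}_{j=0}^{N}$ that are exactly the factors that the Riccati factorization procedure outputs for the penalties $\{\tilde\Sigma_j\}_{j=0}^N$.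 That is, $\tilde L_{xx,N}=\operatorname{chol}(\tilde P_N)$ and, for all $0\le j\le N-1$, $$\begin{pmatrix}\tilde L_{uu,j} & 0\\ \tilde L_{xu,j} & \tilde L_{xx,j}\end{pmatrix}=\operatorname{chol}(\tilde H_j),$$ where $\tilde P_N$ and $\tilde H_j$ denote the matrices $P_N$ and $H_j$ formed by the Riccati factorization procedure when run with the penalties $\{\tilde\Sigma_j\}_{j=0}^N$.
   Context: For a symmetric positive definite matrix $M$, $\operatorname{chol}(M)$ is the lower triangular matrix $L$ with positive diagonal such that $LL^\top=M$. Convention: $\operatorname{sign}(0)=1$. Block rows and columns of size zero are allowed and omitted. **Riccati factorization procedure** (inputs $\{H^l_j\},Q_N,\{F_j\},\{G_j\}$ and penalties $\{\Sigma_j\}$). Set $P_N:=Q_N+G_N^\top\Sigma_N G_N$ and $L_{xx,N}:=\operatorname{chol}(P_N)$. For $j=N-1,N-2,\dots,0$ set $$H_j:=H^l_j+G_j^\top\Sigma_jG_j+F_j^\top L_{xx,j+1}L_{xx,j+1}^\top F_j,\qquad \begin{pmatrix}L_{uu,j}&0\\ L_{xu,j}&L_{xx,j}\end{pmatrix}:=\operatorname{chol}(H_j),$$ with $L_{uu,j}\in\mathbb{R}^{n_u\times n_u}$, $L_{xu,j}\in\mathbb{R}^{n_x\times n_u}$, $L_{xx,j}\in\mathbb{R}^{n_x\times n_x}$. The output consists of all $L_{uu,j},L_{xu,j},L_{xx,j}$. **Block update** (inputs: $L\in\mathbb{R}^{n\times n}$ lower triangular, $A\in\mathbb{R}^{n\times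 m}$, $S\in\mathbb{R}^{m\times m}$ diagonal; outputs: $\tilde L\in\mathbb{R}^{n\times n}$ lower triangular, $B\in\mathbb{R}^{n\times m}$, $T\in\mathbb{R}^{n\times n}$ upper triangular). Set $L_{(1)}:=L$, $A_{(1)}:=A$, and let $B_{(0)},T_{(0)}$ be empty. For $k=1,\dots,n$: partition $L_{(k)}=\begin{pmatrix}\lambda&0\\ \ell&L_{(k+1)}\end{pmatrix}$ and $A_{(k)}=\begin{pmatrix}a^\top\\ A'\end{pmatrix}$ with $\lambda\in\mathbb{R}$, $a\in\mathbb{R}^m$; set $$\sigma:=a^\top S a,\quad \tilde\lambda:=\operatorname{sign}(\lambda)\sqrt{\lambda^2+\sigma},\quad \beta:=\lambda+\tilde\lambda,\quad \tau_{(k)}^{-1}:=\frac{2\beta^2}{\sigma+\beta^2},\quad b_{(k)}:=\beta^{-1}a,$$ $$w:=\tau_{(k)}^{-1}\bigl(\ell+A'Sb_{(k)}\bigr),\quad \tilde\ell:=w-\ell,\quad A_{(k+1)}:=A'-w\,b_{(k)}^\top,$$ let the $k$-th column of $\tilde L$ be $(0,\dots,0,\tilde\lambda,\tilde\ell^\top)^\top$ (with $k-1$ leading zeros), and set $$B_{(k)}:=\begin{pmatrix}B_{(k-1)}\\ b_{(k)}^\top\end{pmatrix},\qquad T_{(k)}:=\begin{pmatrix}T_{(k-1)}&B_{(k-1)}Sb_{(k)}\\0&\tau_{(k)}\end{pmatrix}.$$ Finally $B:=B_{(n)}$ and $T:=T_{(n)}$. **Block apply** (inputs: $L_2\in\mathbb{R}^{l\times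 n}$, $A_2\in\mathbb{R}^{l\times m}$, and $S,B,T$, where $S$ is the diagonal matrix used in a block update and $B,T$ are outputs of that block update; outputs: $\tilde L_2\in\mathbb{R}^{l\times n}$, $\tilde A_2\in\mathbb{R}^{l\times m}$). Set $W:=(L_2+A_2SB^\top)T^{-1}$, $\tilde A_2:=A_2-WB$, $\tilde L_2:=W-L_2$. **Riccati factorization update procedure** (inputs $\{F_j\},\{G_j\},\{\Sigma_j\},\{\tilde\Sigma_j\}$ and old factors $\{L_{uu,j}\},\{L_{xu,j}\},\{L_{xx,j}\}$). Set $\Phi_N:=G_N^\top$ and $S_N:=\tilde\Sigma_N-\Sigma_N$, and let $\tilde L_{xx,N}$ be the updated triangular matrix returned by the block update applied to $(L_{xx,N},\Phi_N,S_N)$. For $j=N-1,N-2,\dots,0$: 1. set $\begin{pmatrix}\Upsilon_{u,j}\\ \Upsilon_{x,j}\end{pmatrix}:=\begin{pmatrix}F_j^\top\Phi_{j+1}&G_j^\top\end{pmatrix}$, where $\Upsilon_{u,j}$ has $n_u$ rows and $\Upsilon_{x,j}$ has $n_x$ rows, and $S_j:=\operatorname{blkdiag}(S_{j+1},\ \tilde\Sigma_j-\Sigma_j)$; 2. apply the block update to $(L_{uu,j},\Upsilon_{u,j},S_j)$, obtaining $\tilde L_{uu,j}$ and matrices $B,T$; 3. apply the block apply operation to $L_2=L_{xu,j}$, $A_2=\Upsilon_{x,j}$ with $S=S_j$ and the $B,T$ from step 2, obtaining $\tilde L_{xu,j}:=\tilde L_2$ and $\Phi_j:=\tilde A_2$;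 4. let $\tilde L_{xx,j}$ be the updated triangular matrix returned by the block update applied to $(L_{xx,j},\Phi_j,S_j)$. The output consists of all $\tilde L_{uu,j},\tilde L_{xu,j},\tilde L_{xx,j}$. *)

(* Defs.v *)
From mathcomp Require Import all_boot all_order all_algebra.
From mathcomp Require Import classical_sets.

Set Implicit Arguments.
Unset Strict Implicit.
Unset Printing Implicit Defensive.

Import Order.TTheory GRing.Theory Num.Theory.
Local Open Scope ring_scope.

Section Cholesky.
Variables (R : rcfType) (n : nat).

(* Symmetry is not included: every matrix this is used for is symmetric as
   soon as the data are. *)
Definition posdefmx (M : 'M[R]_n) : Prop :=
  forall x : 'cV[R]_n, x != 0 -> 0 < (x^T *m M *m x) 0 0.

(* [is_trig_mx] means lower triangular. *)
Definition is_chol (M L : 'M[R]_n) : Prop :=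
  [/\ is_trig_mx L, forall i, 0 < L i i & L *m L^T = M].

(* The factor is unique when it exists; the value 0 is returned when [M] has
   no Cholesky factor. *)
Definition chol (M : 'M[R]_n) : 'M[R]_n := xget 0 (is_chol M).

End Cholesky.

Section RiccatiFactorization.
Variables (R : rcfType) (N nu nx : nat) (c : nat -> nat).
(* Families are indexed by all of [nat]: only the stages j < N of [Hl], [F],
   [G] and the stages j <= N of [c], [Sigma] are ever used. *)
Variables (Hl : nat -> 'M[R]_(nu + nx)) (QN : 'M[R]_nx).
Variables (F : nat -> 'M[R]_(nx, nu + nx)).
Variables (G : forall j, 'M[R]_(c j, nu + nx)) (GN : 'M[R]_(c N, nx)).
Variable Sigma : forall j, 'M[R]_(c j).

Definition riccati_PN : 'M[R]_nx := QN + GN^T *m Sigma N *m GN.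

Definition riccati_Hstep (j : nat) (Lxx1 : 'M[R]_nx) : 'M[R]_(nu + nx) :=
  Hl j + (G j)^T *m Sigma j *m G j + (F j)^T *m Lxx1 *m Lxx1^T *m F j.

(* [riccati_Lxx_rev k] is the factor L_xx of stage N - k. *)
Fixpoint riccati_Lxx_rev (k : nat) : 'M[R]_nx :=
  if k is k'.+1
  then drsubmx (chol (riccati_Hstep (N - k) (riccati_Lxx_rev k')))
  else chol riccati_PN.

Definition riccati_Lxx (j : nat) : 'M[R]_nx := riccati_Lxx_rev (N - j).

Definition riccati_H (j : nat) : 'M[R]_(nu + nx) :=
  riccati_Hstep j (riccati_Lxx j.+1).

Definition riccati_Luu (j : nat) : 'M[R]_nu := ulsubmx (chol (riccati_H j)).

Definition riccati_Lxu (j : nat) : 'M[R]_(nx, nu) :=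
  dlsubmx (chol (riccati_H j)).

Definition riccati_well_defined : Prop :=
  posdefmx riccati_PN /\ forall j, (j < N)%N -> posdefmx (riccati_H j).

End RiccatiFactorization.

Section BlockUpdate.
Variables (R : rcfType) (m : nat) (S : 'M[R]_m).

(* Unlike [Num.sg], this has value 1 at 0. *)
Definition sign1 (x : R) : R := if 0 <= x then 1 else -1.

(* One elimination step. The vectors a and b are kept as rows, i.e. [a] and
   [pivot_b lam a] stand for a^T and b^T. *)
Definition pivot_sigma (a : 'rV[R]_m) : R := (a *m S *m a^T) 0 0.

Definition pivot_lambda (lam : R) (a : 'rV[R]_m) : R :=
  sign1 lam * Num.sqrt (lam ^+ 2 + pivot_sigma a).

Definition pivot_beta (lam : R) (a : 'rV[R]_m) : R :=
  lam + pivot_lambda lam a.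

Definition pivot_tauV (lam : R) (a : 'rV[R]_m) : R :=
  2 * pivot_beta lam a ^+ 2 / (pivot_sigma a + pivot_beta lam a ^+ 2).

Definition pivot_b (lam : R) (a : 'rV[R]_m) : 'rV[R]_m :=
  (pivot_beta lam a)^-1 *: a.

Definition pivot_w (n : nat) (lam : R) (l : 'cV[R]_n)
    (a : 'rV[R]_m) (A' : 'M[R]_(n, m)) : 'cV[R]_n :=
  pivot_tauV lam a *: (l + A' *m S *m (pivot_b lam a)^T).

(* Returns the updated factor, the matrix B, and the row of the diagonal
   entries tau of T. *)
Fixpoint block_update_loop (n : nat) :
    'M[R]_n -> 'M[R]_(n, m) -> 'M[R]_n * 'M[R]_(n, m) * 'rV[R]_n :=
  match n with
  | 0 => fun _ _ => (0, 0, 0)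
  | n'.+1 => fun (L : 'M[R]_(1 + n')) (A : 'M[R]_(1 + n', m)) =>
      let lam := L 0 0 in
      let l : 'cV[R]_n' := dlsubmx L in
      let a : 'rV[R]_m := usubmx A in
      let A' : 'M[R]_(n', m) := dsubmx A in
      let b := pivot_b lam a in
      let w := pivot_w lam l a A' in
      let: (L', B', tau') := block_update_loop (drsubmx L) (A' - w *m b) in
      (block_mx (pivot_lambda lam a)%:M 0 (w - l) L',
       col_mx b B',
       row_mx (pivot_tauV lam a)^-1%:M tau')
  end.

Definition block_update_L (n : nat) (L : 'M[R]_n) (A : 'M[R]_(n, m)) :
    'M[R]_n := (block_update_loop L A).1.1.

Definition block_update_B (n : nat) (L : 'M[R]_n) (A : 'M[R]_(n, m)) :
    'M[R]_(n, m) := (block_update_loop L A).1.2.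

(* Column k of T is B_(k-1) S b_(k) on top of tau_(k): row i < k of it is
   b_(i)^T S b_(k). *)
Definition block_update_T (n : nat) (L : 'M[R]_n) (A : 'M[R]_(n, m)) :
    'M[R]_n :=
  let B := block_update_B L A in
  \matrix_(i, k) if (i < k)%N then (B *m S *m B^T) i k
                 else if i == k then (block_update_loop L A).2 0 k
                 else 0.

(* Every square root taken has a nonnegative argument and every division has
   a nonzero denominator. *)
Fixpoint block_update_defined (n : nat) : 'M[R]_n -> 'M[R]_(n, m) -> bool :=
  match n with
  | 0 => fun _ _ => true
  | n'.+1 => fun (L : 'M[R]_(1 + n')) (A : 'M[R]_(1 + n', m)) =>
      let lam := L 0 0 in
      let l : 'cV[R]_n' := dlsubmx L in
      let a : 'rV[R]_m := usubmx A in
      let A' : 'M[R]_(n', m) := dsubmx A in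
      [&& 0 <= lam ^+ 2 + pivot_sigma a,
          pivot_beta lam a != 0,
          pivot_sigma a + pivot_beta lam a ^+ 2 != 0
        & block_update_defined (drsubmx L)
            (A' - pivot_w lam l a A' *m pivot_b lam a)]
  end.

End BlockUpdate.

Section BlockApply.
Variables (R : rcfType) (l n m : nat).
Variables (L2 : 'M[R]_(l, n)) (A2 : 'M[R]_(l, m)).
Variables (S : 'M[R]_m) (B : 'M[R]_(n, m)) (T : 'M[R]_n).

Definition block_apply_W : 'M[R]_(l, n) :=
  (L2 + A2 *m S *m B^T) *m invmx T.

Definition block_apply_A : 'M[R]_(l, m) := A2 - block_apply_W *m B.

Definition block_apply_L : 'M[R]_(l, n) := block_apply_W - L2.

End BlockApply.

(* The pair (Phi_j, S_j), whose width c_N + ... + c_j varies with j. *)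
Record update_state (R : rcfType) (nx : nat) := UpdateState {
  us_width : nat;
  us_Phi : 'M[R]_(nx, us_width);
  us_S : 'M[R]_us_width
}.

Section RiccatiUpdate.
Variables (R : rcfType) (N nu nx : nat) (c : nat -> nat).
Variables (F : nat -> 'M[R]_(nx, nu + nx)).
Variables (G : forall j, 'M[R]_(c j, nu + nx)) (GN : 'M[R]_(c N, nx)).
Variables (Sigma Sigma' : forall j, 'M[R]_(c j)).
Variables (Luu : nat -> 'M[R]_nu) (Lxu : nat -> 'M[R]_(nx, nu)).
Variable (Lxx : nat -> 'M[R]_nx).

Section Step.
(* [st] is the state (Phi_{j+1}, S_{j+1}) of the following stage. *)
Variables (j : nat) (st : update_state R nx).

Definition step_Upsilon : 'M[R]_(nu + nx, us_width st + c j) :=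
  row_mx ((F j)^T *m us_Phi st) (G j)^T.

Definition step_S : 'M[R]_(us_width st + c j) :=
  block_mx (us_S st) 0 0 (Sigma' j - Sigma j).

Definition step_Luu : 'M[R]_nu :=
  block_update_L step_S (Luu j) (usubmx step_Upsilon).

Definition step_B : 'M[R]_(nu, us_width st + c j) :=
  block_update_B step_S (Luu j) (usubmx step_Upsilon).

Definition step_T : 'M[R]_nu :=
  block_update_T step_S (Luu j) (usubmx step_Upsilon).

Definition step_Lxu : 'M[R]_(nx, nu) :=
  block_apply_L (Lxu j) (dsubmx step_Upsilon) step_S step_B step_T.

Definition step_Phi : 'M[R]_(nx, us_width st + c j) :=
  block_apply_A (Lxu j) (dsubmx step_Upsilon) step_S step_B step_T.

Definition step_Lxx : 'M[R]_nx := block_update_L step_S (Lxx j) step_Phi.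

Definition step_state : update_state R nx := UpdateState step_Phi step_S.

Definition step_defined : bool :=
  [&& block_update_defined step_S (Luu j) (usubmx step_Upsilon),
      step_T \in unitmx
    & block_update_defined step_S (Lxx j) step_Phi].

End Step.

(* [update_state_rev k] is the state (Phi_j, S_j) of stage j = N - k. *)
Fixpoint update_state_rev (k : nat) : update_state R nx :=
  if k is k'.+1 then step_state (N - k) (update_state_rev k')
  else UpdateState GN^T (Sigma' N - Sigma N).

Definition update_state_at (j : nat) : update_state R nx :=
  update_state_rev (N - j).

Definition update_Luu (j : nat) : 'M[R]_nu :=
  step_Luu j (update_state_at j.+1).

Definition update_Lxu (j : nat) : 'M[R]_(nx, nu) :=
  step_Lxu j (update_state_at j.+1).

Definition update_Lxx (j : nat) : 'M[R]_nx :=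
  if (j < N)%N then step_Lxx j (update_state_at j.+1)
  else block_update_L (Sigma' N - Sigma N) (Lxx N) GN^T.

Definition update_well_defined : Prop :=
  block_update_defined (Sigma' N - Sigma N) (Lxx N) GN^T /\
  forall j, (j < N)%N -> step_defined j (update_state_at j.+1).

End RiccatiUpdate.

(* Main.v *)
Require Import Defs.
From mathcomp Require Import all_boot all_order all_algebra.
From mathcomp Require Import classical_sets.
From mathcomp Require Import ring lra.

Set Implicit Arguments.
Unset Strict Implicit.
Unset Printing Implicit Defensive.

Import Order.TTheory GRing.Theory Num.Theory.
Local Open Scope ring_scope.

(** A stage of the Riccati recursion replaces a matrix [H = K K^T] by
[H + A S A^T], where [K] is its Cholesky factor and [S] is symmetric but in
general indefinite.  The update is right because it acts on the pair [(K A)]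
on the right by a matrix that is orthogonal for the form [diag(1, S)]: such a
matrix leaves [K K^T + A S A^T] unchanged, and it is chosen so as to turn [A]
into 0 while keeping [K] lower triangular with positive diagonal.  The result
is then a Cholesky factor of [H + A S A^T], and there is only one.

The transformation is a product of hyperbolic Householder reflections, one for
each column of [K], and the matrices [B] and [T] encode this product: writing
[W T = L + A S B^T], it sends [(L A)] to [(W - L, A - W B)].  It is orthogonal
as soon as [T + T^T = 1 + B S B^T] ([reflection_isometry]).  The predicate
[eliminates] says that this identity holds and that the rows [(L A)] are sent
to [(L' 0)].  It holds for a single pivot ([pivot_eliminates]) and is stable
under adding block rows and columns ([eliminates_block]); hence it holds for
the block update ([block_update_spec]), and a block update followed by a block
apply and a second block update is the block form of one large update
([block_update_apply_spec]).

No division by zero and no square root of a negative number can occur.  After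
some columns have been eliminated, [L L^T + A S A^T] for the remaining rows is
the Schur complement of the eliminated part in the updated matrix, so it is
still positive definite ([posdefmx_schur]), and its first diagonal entry is
the radicand of the next pivot.

Going backwards in time, the rows [Phi_j] left by stage [j] satisfy
[Lxx'_j Lxx'_j^T = Lxx_j Lxx_j^T + Phi_j S_j Phi_j^T] ([state_tracks]).  This
is the change of the cost-to-go matrix, and it makes the matrix factored at
the preceding stage change by [Upsilon S Upsilon^T] ([riccati_H_update]),
which is what the update of that stage takes into account ([update_stage]). *)

(** * Positive definite matrices and Cholesky factors *)

Lemma posdiag_trig_blocks (R : rcfType) (n1 n2 : nat) (M : 'M[R]_(n1 + n2)) :
  is_trig_mx M -> (forall i, 0 < M i i) ->
  [/\ M = block_mx (ulsubmx M) 0 (dlsubmx M) (drsubmx M),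
      is_trig_mx (ulsubmx M), forall i, 0 < ulsubmx M i i,
      is_trig_mx (drsubmx M) & forall i, 0 < drsubmx M i i].
Proof.
move=> trM posM; have M_E := submxK M.
have := trM; rewrite -{1}M_E is_trig_block_mx // => /and3P[/eqP ur0 trul trdr].
split=> // [|i|i]; first by rewrite -{1}M_E ur0.
  by rewrite !mxE; apply: posM.
by rewrite !mxE; apply: posM.
Qed.

Lemma block_llt (R : rcfType) (n1 n2 : nat) (P : 'M[R]_n1)
    (Q : 'M[R]_(n2, n1)) (K : 'M[R]_n2) :
  block_mx P 0 Q K *m (block_mx P 0 Q K)^T
  = col_mx P Q *m (col_mx P Q)^T + block_mx 0 0 0 (K *m K^T).
Proof.
rewrite tr_block_mx mulmx_block tr_col_mx mul_col_row add_block_mx.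
by rewrite !trmx0 !mulmx0 !mul0mx !addr0.
Qed.

(** On the vectors [y] with [(col_mx P Q)^T y = 0] the quadratic form of the
whole matrix only sees [D], and since [P] is invertible every lower part [x]
extends to such a vector. *)
Lemma posdefmx_schur (R : rcfType) (n1 n2 : nat) (P : 'M[R]_n1)
    (Q : 'M[R]_(n2, n1)) (D : 'M[R]_n2) :
  P \in unitmx ->
  posdefmx (col_mx P Q *m (col_mx P Q)^T + block_mx 0 0 0 D) ->
  posdefmx D.
Proof.
move=> uP pM x x0.
(* the upper part solves P^T y1 = - Q^T x *)
pose y := col_mx (- (invmx P^T *m (Q^T *m x))) x.
have y0 : y != 0 by rewrite col_mx_eq0 (negPf x0) andbF.
have Ky : (col_mx P Q)^T *m y = 0.
  by rewrite tr_col_mx mul_row_col mulmxN mulKVmx ?unitmx_tr // addNr.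
have := pM y y0; rewrite mulmxDr mulmxDl -!mulmxA Ky !mulmx0 add0r.
rewrite mul_block_col !mul0mx !add0r /y tr_col_mx mul_row_col mulmx0 add0r.
by rewrite mulmxA.
Qed.

Lemma posdefmx_ulsub (R : rcfType) (n1 n2 : nat) (A : 'M[R]_n1) B C
    (D : 'M[R]_n2) :
  posdefmx (block_mx A B C D) -> posdefmx A.
Proof.
move=> pM x x0.
have y0 : col_mx x (0 : 'cV[R]_n2) != 0.
  by rewrite col_mx_eq0 (negPf x0).
have := pM _ y0; rewrite tr_col_mx trmx0 mul_row_block mul_row_col.
by rewrite !mul0mx mulmx0 !addr0.
Qed.

Lemma trig_unitmx (R : rcfType) (n : nat) (L : 'M[R]_n) :
  is_trig_mx L -> (forall i, 0 < L i i) -> L \in unitmx.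
Proof.
move=> trL posL; rewrite unitmxE unitfE det_trig //.
by apply/prodf_neq0 => i _; rewrite gt_eqF.
Qed.

Lemma is_chol_block (R : rcfType) (n1 n2 : nat) (M1 P : 'M[R]_n1)
    (Q : 'M[R]_(n2, n1)) (D K : 'M[R]_n2) :
  is_chol M1 P -> is_chol D K ->
  is_chol (col_mx P Q *m (col_mx P Q)^T + block_mx 0 0 0 D) (block_mx P 0 Q K).
Proof.
move=> [trP posP _] [trK posK <-]; split; last exact: block_llt.
  by rewrite is_trig_block_mx // eqxx trP.
by move=> i; rewrite -(splitK i); case: (split i) => k /=;
  rewrite ?block_mxEul ?block_mxEdr.
Qed.

Lemma posdefmx_diag_gt0 (R : rcfType) (n : nat) (M : 'M[R]_n) (i : 'I_n) :
  posdefmx M -> 0 < M i i.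
Proof.
have e0 : (delta_mx i 0 : 'cV[R]_n) != 0.
  by apply/eqP => /matrixP/(_ i 0)/eqP; rewrite !mxE !eqxx oner_eq0.
by move=> /(_ _ e0); rewrite trmx_delta -rowE -colE !mxE.
Qed.

Lemma is_chol11 (R : rcfType) (x : R) :
  0 < x -> is_chol ((x ^+ 2)%:M : 'M_1) x%:M.
Proof.
move=> x0; split; first exact: scalar_mx_is_trig.
  by move=> i; rewrite mxE eqxx.
by rewrite tr_scalar_mx -scalar_mxM.
Qed.

(** The upper left block fixes the first pivot up to sign, the lower left block
then fixes the rest of the first column, and induction applies to the
difference of the lower right blocks. *)
Lemma is_chol_inj (R : rcfType) (n : nat) (M L L' : 'M[R]_n) :
  is_chol M L -> is_chol M L' -> L = L'.
Proof.
elim: n => [|n IHn] in M L L' *; first by rewrite [L]flatmx0 [L']flatmx0.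
move: M L L'; rewrite -[n.+1]/(1 + n)%N => M L L'.
move=> [+ + LL] [+ + LL'].
move=> /posdiag_trig_blocks /[apply] [[L_E _ p0 tr ps]].
move=> /posdiag_trig_blocks /[apply] [[L'_E _ p0' tr' ps']].
have := etrans LL (esym LL'); rewrite L_E L'_E.
move: (p0 0) (p0' 0); rewrite [ulsubmx L]mx11_scalar [ulsubmx L']mx11_scalar.
set x := ulsubmx L 0 0; set x' := ulsubmx L' 0 0.
rewrite !mxE !eqxx !mulr1n => x0 x'0.
rewrite !tr_block_mx !mulmx_block !trmx0 !mulmx0 !mul0mx !addr0.
rewrite !tr_scalar_mx => /eq_block_mx[xx _ dl dr].
have x_E : x = x'.
  move: xx; rewrite -!scalar_mxM => /(congr1 (fun A : 'M_1 => A 0 0)).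
  by rewrite !mxE !mulr1n => /eqP; rewrite -!expr2 eqrXn2 ?ltW // => /eqP.
have dl_E : dlsubmx L = dlsubmx L'.
  move: dl; rewrite -x_E !mul_mx_scalar => /(congr1 ( *:%R x^-1)).
  by rewrite !scalerA mulVf ?gt_eqF // !scale1r.
rewrite x_E dl_E; congr block_mx.
apply: (IHn (drsubmx L *m (drsubmx L)^T)) => //.
by split=> //; apply: (addrI (dlsubmx L *m (dlsubmx L)^T)); rewrite dr dl_E.
Qed.

Lemma chol_eq (R : rcfType) (n : nat) (M L : 'M[R]_n) :
  is_chol M L -> chol M = L.
Proof.
by move=> ML; apply: (@is_chol_inj _ _ M) => //; apply: (xgetPex 0); exists L.
Qed.

(** The first column of the factor is forced; what remains to be factored is a
Schur complement, which is positive definite by [posdefmx_schur]. *)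
Lemma posdefmx_is_chol (R : rcfType) (n : nat) (M : 'M[R]_n) :
  M^T = M -> posdefmx M -> is_chol M (chol M).
Proof.
suff : M^T = M -> posdefmx M -> exists L, is_chol M L.
  by move=> ex sM pM; have [L ML] := ex sM pM; rewrite (chol_eq ML).
elim: n => [|n IHn] in M *.
  move=> _ _; exists 0; split; first by apply/is_trig_mxP => -[].
    by case.
  by rewrite [M]flatmx0 mul0mx.
move: M; rewrite -[n.+1]/(1 + n)%N => M sM pM.
pose a := M 0 0; pose l : 'cV_n := (Num.sqrt a)^-1 *: dlsubmx M.
have a0 : 0 < a := posdefmx_diag_gt0 0 pM.
have s0 : 0 < Num.sqrt a by rewrite sqrtr_gt0.
pose D := drsubmx M - l *m l^T.
have M_E : M = col_mx (Num.sqrt a)%:M l *m (col_mx (Num.sqrt a)%:M l)^T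
               + block_mx 0 0 0 D.
  have dl_E : Num.sqrt a *: l = dlsubmx M.
    by rewrite scalerA mulfV ?gt_eqF // scale1r.
  rewrite tr_col_mx mul_col_row add_block_mx !addr0 addrC subrK -[LHS]submxK.
  rewrite tr_scalar_mx -scalar_mxM -expr2 sqr_sqrtr ?ltW //.
  rewrite mul_scalar_mx mul_mx_scalar -linearZ /= dl_E.
  rewrite trmx_dlsub sM; congr block_mx.
  by rewrite [LHS]mx11_scalar !mxE; congr (M _ _)%:M; apply/val_inj.
have [||K DK] := IHn D.
- by rewrite /D linearB /= trmx_mul trmxK trmx_drsub sM.
- apply: (@posdefmx_schur _ 1 _ (Num.sqrt a)%:M l); last by rewrite -M_E.
  by rewrite unitmxE det_scalar1 unitfE gt_eqF.
exists (block_mx (Num.sqrt a)%:M 0 l K); rewrite M_E.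
exact: is_chol_block (is_chol11 s0) DK.
Qed.

(** * Products of hyperbolic reflections *)

Section Reflection.
Variables (R : rcfType) (m : nat) (S : 'M[R]_m).
Hypothesis S_sym : S^T = S.

(** [L + L'] is the matrix [W] for which the transformation encoded by [B] and
[T] sends [(L A)] to [(W - L, A - W B)]; the last two equations say that the
image is [(L' 0)], the second that the transformation preserves
[diag(1, S)]. *)
Definition eliminates (n : nat) (L : 'M[R]_n) (A : 'M[R]_(n, m))
    (L' : 'M[R]_n) (B : 'M[R]_(n, m)) (T : 'M[R]_n) : Prop :=
  [/\ T \in unitmx, T + T^T = 1%:M + B *m S *m B^T,
      (L + L') *m T = L + A *m S *m B^T & (L + L') *m B = A].

(** Expanding the left side leaves [W (1 + B S B^T) W^T - W (W T)^T - (W T) W^T]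
in addition to the right side, and this vanishes because
[1 + B S B^T = T + T^T]. *)
Lemma reflection_isometry (n p : nat) (B : 'M[R]_(n, m)) (T : 'M[R]_n)
    (L W : 'M[R]_(p, n)) (A : 'M[R]_(p, m)) :
  T + T^T = 1%:M + B *m S *m B^T -> W *m T = L + A *m S *m B^T ->
  (W - L) *m (W - L)^T + (A - W *m B) *m S *m (A - W *m B)^T
  = L *m L^T + A *m S *m A^T.
Proof.
move=> TT WT.
have WTT : T^T *m W^T = L^T + B *m S *m A^T.
  by rewrite -trmx_mul WT linearD /= !trmx_mul trmxK S_sym mulmxA.
have E : W *m T *m W^T + W *m (T^T *m W^T)
    = W *m W^T + W *m B *m S *m B^T *m W^T.
  by rewrite mulmxA -mulmxDl -mulmxDr TT mulmxDr mulmx1 mulmxDl !mulmxA.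
move: E; rewrite WT WTT.
rewrite [(W - L)^T]linearB [(A - W *m B)^T]linearB /= trmx_mul.
rewrite !(mulmxDr, mulmxDl, mulmxN, mulNmx).
rewrite !mulmxA.
move: (L *m W^T) (A *m S *m B^T *m W^T) (W *m L^T) (W *m B *m S *m A^T)
  (W *m W^T) (W *m B *m S *m B^T *m W^T) (L *m L^T) (A *m S *m A^T).
move=> X1 X2 X3 X4 X5 X6 X7 X8 /matrixP E; apply/matrixP => i j.
by move: (E i j); rewrite !mxE; lra.
Qed.

(** Composition of two eliminations.  The first one is applied to the lower
rows [(L2 A2)] as well, and the second one starts from what it makes of [A2];
the corner [B S B1^T] of the new [T] is exactly the contribution of the cross
terms to [1 + B S B^T], and this is where the upper triangular [T] of the
algorithm comes from. *)
Lemma eliminates_block (n1 n2 : nat) (L : 'M[R]_n1) (A : 'M[R]_(n1, m))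
    (L' : 'M[R]_n1) (B : 'M[R]_(n1, m)) (T : 'M[R]_n1) (L2 W : 'M[R]_(n2, n1))
    (A2 : 'M[R]_(n2, m)) (L1 L1' : 'M[R]_n2) B1 (T1 : 'M[R]_n2) :
  eliminates L A L' B T -> W *m T = L2 + A2 *m S *m B^T ->
  eliminates L1 (A2 - W *m B) L1' B1 T1 ->
  eliminates (block_mx L 0 L2 L1) (col_mx A A2) (block_mx L' 0 (W - L2) L1')
    (col_mx B B1) (block_mx T (B *m S *m B1^T) 0 T1).
Proof.
move=> [uT TT XT XB] WT [uT1 TT1 X1T X1B]; split.
- by rewrite unitmxE det_ublock unitrM -!unitmxE uT.
- rewrite tr_block_mx add_block_mx trmx0 tr_col_mx mul_col_mx mul_col_row.
  rewrite scalar_mx_block add_block_mx !addr0 !add0r TT TT1.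
  by rewrite !trmx_mul trmxK S_sym mulmxA.
- rewrite add_block_mx [L2 + _]addrC subrK addr0 mulmx_block.
  rewrite !mulmx0 !mul0mx !addr0 XT WT X1T !mulmxA XB.
  rewrite tr_col_mx mul_col_mx mul_col_row add_block_mx add0r.
  congr block_mx; rewrite !mulmxBl addrC -!addrA; congr (_ + _).
  by rewrite addNr addr0.
- rewrite add_block_mx [L2 + _]addrC subrK addr0 mul_block_col.
  by rewrite mul0mx addr0 XB X1B addrC subrK.
Qed.

(** The left factor of the first term on the right is an already final block
column of the new Cholesky factor, and the lower right block is what later
eliminations have to factor. *)
Lemma eliminates_llt (n1 n2 : nat) (L : 'M[R]_n1) (A : 'M[R]_(n1, m))
    (L' : 'M[R]_n1) (B : 'M[R]_(n1, m)) (T : 'M[R]_n1) (L2 W : 'M[R]_(n2, n1))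
    (A2 : 'M[R]_(n2, m)) (L1 : 'M[R]_n2) :
  eliminates L A L' B T -> W *m T = L2 + A2 *m S *m B^T ->
  block_mx L 0 L2 L1 *m (block_mx L 0 L2 L1)^T
    + col_mx A A2 *m S *m (col_mx A A2)^T
  = col_mx L' (W - L2) *m (col_mx L' (W - L2))^T
    + block_mx 0 0 0
        (L1 *m L1^T + (A2 - W *m B) *m S *m (A2 - W *m B)^T).
Proof.
move=> [_ TT XT XB] WT.
have WT2 : col_mx (L + L') W *m T = col_mx L L2 + col_mx A A2 *m S *m B^T.
  by rewrite !mul_col_mx add_col_mx XT WT.
have := reflection_isometry TT WT2.
rewrite [_ *m B]mul_col_mx XB !opp_col_mx !add_col_mx subrr.
rewrite [L + L' - L]addrC addKr.
rewrite block_llt addrAC => <-; rewrite -addrA; congr (_ + _).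
rewrite mul_col_mx mul0mx tr_col_mx mul_col_row trmx0 !mulmx0 !mul0mx.
by rewrite add_block_mx !addr0 addrC.
Qed.

(** With [beta = lam + mu] and [mu ^+ 2 = lam ^+ 2 + sigma] one has
[sigma + beta ^+ 2 = 2 * mu * beta], so that [tau = mu / beta]; positivity of
[lam] and [mu] therefore keeps every denominator away from 0. *)
Lemma pivot_eliminates (lam : R) (a : 'rV[R]_m) :
  0 < lam -> 0 < lam ^+ 2 + pivot_sigma S a ->
  [/\ 0 < pivot_lambda S lam a, 0 < pivot_beta S lam a,
      0 < pivot_sigma S a + pivot_beta S lam a ^+ 2,
      pivot_tauV S lam a != 0 &
      eliminates lam%:M a (pivot_lambda S lam a)%:M (pivot_b S lam a)
        (pivot_tauV S lam a)^-1%:M].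
Proof.
move=> lam0 sum0; set s := pivot_sigma S a in sum0 *.
rewrite /pivot_b /pivot_tauV /pivot_beta.
have l2 : pivot_lambda S lam a ^+ 2 = lam ^+ 2 + s.
  by rewrite /pivot_lambda /sign1 ltW // mul1r sqr_sqrtr // ltW.
have l0 : 0 < pivot_lambda S lam a.
  by rewrite /pivot_lambda /sign1 ltW // mul1r sqrtr_gt0.
move: (pivot_lambda S lam a) l2 l0 => mu l2 l0; rewrite -/s.
have b0 : 0 < lam + mu by rewrite addr_gt0.
have sE : s = mu ^+ 2 - lam ^+ 2 by rewrite l2 addrC addKr.
have sbE : s + (lam + mu) ^+ 2 = 2 * mu * (lam + mu) by rewrite sE; ring.
have sb0 : 0 < s + (lam + mu) ^+ 2 by rewrite sbE !mulr_gt0.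
have t0 : 2 * (lam + mu) ^+ 2 / (s + (lam + mu) ^+ 2) != 0.
  by rewrite gt_eqF // divr_gt0 // mulr_gt0 // exprn_gt0.
have aSa : a *m S *m a^T = s%:M by rewrite [LHS]mx11_scalar.
have bn0 : lam + mu != 0 by rewrite gt_eqF.
have mun0 : mu != 0 by rewrite gt_eqF.
split=> //; split.
- by rewrite unitmxE det_scalar1 unitfE invr_eq0.
- rewrite !linearZ /= -!scalemxAl aSa tr_scalar_mx.
  rewrite !scale_scalar_mx -!raddfD /=; congr _%:M.
  rewrite sbE sE; field; exact/andP.
- rewrite linearZ /= -scalemxAr aSa !scale_scalar_mx -!raddfD -scalar_mxM /=.
  congr _%:M; rewrite sbE sE; field; exact/andP.
- by rewrite -raddfD /= mul_scalar_mx scalerA mulfV // scale1r.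
Qed.

Lemma block_update_loop_cons (n : nat) (lam : R) (l : 'cV[R]_n) (L1 : 'M[R]_n)
    (a : 'rV[R]_m) (A1 : 'M[R]_(n, m)) :
  let L : 'M[R]_n.+1 := block_mx lam%:M 0 l L1 : 'M_(1 + n) in
  let A : 'M[R]_(n.+1, m) := col_mx a A1 : 'M_(1 + n, m) in
  let b := pivot_b S lam a in
  let w := pivot_w S lam l a A1 in
  let A1' := A1 - w *m b in
  [/\ block_update_L S L A = block_mx (pivot_lambda S lam a)%:M 0 (w - l)
        (block_update_L S L1 A1'),
      block_update_B S L A = col_mx b (block_update_B S L1 A1'),
      block_update_T S L A =
        block_mx (pivot_tauV S lam a)^-1%:M (b *m S *m (block_update_B S L1 A1')^T)
          0 (block_update_T S L1 A1')
    & block_update_defined S L A =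
        [&& 0 <= lam ^+ 2 + pivot_sigma S a, pivot_beta S lam a != 0,
            pivot_sigma S a + pivot_beta S lam a ^+ 2 != 0
          & block_update_defined S L1 A1']].
Proof.
move=> L A b w A1'.
have L00 : L 0 0 = lam.
  have -> : (0 : 'I_n.+1) = lshift n (0 : 'I_1) by apply: ord_inj.
  by rewrite [LHS]block_mxEul mxE.
have loopE : block_update_loop S L A =
  (block_mx (pivot_lambda S lam a)%:M 0 (w - l) (block_update_L S L1 A1'),
   col_mx b (block_update_B S L1 A1'),
   row_mx (pivot_tauV S lam a)^-1%:M (block_update_loop S L1 A1').2).
  rewrite /block_update_L /block_update_B /= L00 /L /A.
  rewrite block_mxKdl block_mxKdr col_mxKu col_mxKd -/b -/w -/A1'.
  by case: (block_update_loop S L1 A1') => [[]].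
have B_E : block_update_B S L A = col_mx b (block_update_B S L1 A1').
  by rewrite /block_update_B loopE.
split=> //; first by rewrite /block_update_L loopE.
  rewrite /block_update_T B_E loopE /=.
  set B1 := block_update_B S L1 A1'.
  have BSB : col_mx b B1 *m S *m (col_mx b B1)^T
      = block_mx (b *m S *m b^T) (b *m S *m B1^T)
                 (B1 *m S *m b^T) (B1 *m S *m B1^T).
    by rewrite tr_col_mx mul_col_mx mul_col_row.
  apply/matrixP => i k; rewrite mxE [_ *m _^T]BSB.
  rewrite -(@splitK 1 n i) -(@splitK 1 n k).
  case: (@split 1 n i) => {}i; case: (@split 1 n k) => {}k /=.
  - by rewrite !ord1 ltnn eqxx [RHS]block_mxEul [LHS]row_mxEl.
  - by rewrite !ord1 [RHS]block_mxEur [LHS]block_mxEur.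
  - by rewrite !ord1 ltn0 -val_eqE /= [RHS]block_mxEdl mxE.
  - rewrite !add1n ltnS -val_eqE /= !add1n eqSS val_eqE.
    rewrite [RHS]block_mxEdr mxE; case: ifP => _; first exact: block_mxEdr.
    by case: ifP => // _; exact: row_mxEr.
by rewrite /= L00 /L /A block_mxKdl block_mxKdr col_mxKu col_mxKd.
Qed.

(** Positive definiteness is used for the pivots only: its first diagonal entry
is the radicand of the current pivot, and by [eliminates_llt] and
[posdefmx_schur] it is inherited by the remaining rows. *)
Lemma block_update_spec (n : nat) (L : 'M[R]_n) (A : 'M[R]_(n, m)) :
  is_trig_mx L -> (forall i, 0 < L i i) ->
  posdefmx (L *m L^T + A *m S *m A^T) ->
  [/\ block_update_defined S L A,
      is_chol (L *m L^T + A *m S *m A^T) (block_update_L S L A)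
    & eliminates L A (block_update_L S L A) (block_update_B S L A)
        (block_update_T S L A)].
Proof.
elim: n => [|n IHn] in L A *.
  move=> _ _ _; split=> //; last first.
    by split; rewrite ?unitmxE ?det_mx00 ?unitr1 //; apply/matrixP => -[].
  split; [by apply/is_trig_mxP => -[] | by case |].
  by apply/matrixP => -[].
move: L A; rewrite -[n.+1]/(1 + n)%N => L A.
move=> /posdiag_trig_blocks /[apply] [[L_E _ + + +]].
rewrite [in X in _ -> _ -> _ -> X]L_E -[A]vsubmxK.
move: (usubmx A) (dsubmx A) (ulsubmx L) (dlsubmx L) (drsubmx L).
move=> {L_E L A}a A1 lam l L1; rewrite [lam]mx11_scalar.
move: (lam 0 0) => {}lam /(_ 0); rewrite mxE eqxx mulr1n => lam0 tr1 pos1 pM.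
have sum0 : 0 < lam ^+ 2 + pivot_sigma S a.
  have := posdefmx_diag_gt0 (lshift n 0) pM.
  rewrite tr_block_mx mulmx_block mul_col_mx tr_col_mx mul_col_row.
  rewrite add_block_mx block_mxEul mul0mx addr0 tr_scalar_mx -scalar_mxM.
  by rewrite 2!mxE eqxx.
have [mu0 b0 sb0 t0 el0] := pivot_eliminates lam0 sum0.
have wT : pivot_w S lam l a A1 *m (pivot_tauV S lam a)^-1%:M
    = l + A1 *m S *m (pivot_b S lam a)^T.
  by rewrite mul_mx_scalar scalerA mulVf // scale1r.
have llt := eliminates_llt L1 el0 wT.
have mu_unit : (pivot_lambda S lam a)%:M \in @unitmx R 1.
  by rewrite unitmxE det_scalar1 unitfE gt_eqF.
have [df1 ch1 el1] := IHn _ _ tr1 pos1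
  (posdefmx_schur mu_unit (eq_ind _ (@posdefmx _ _) pM _ llt)).
have [-> -> -> ->] := block_update_loop_cons lam l L1 a A1.
split.
- by rewrite ltW //= !gt_eqF.
- by rewrite llt; apply: is_chol_block ch1; apply: is_chol11.
- exact: eliminates_block.
Qed.

(** The block apply step solves [W T = L2 + A2 S B^T] for the lower rows, hence
it extends the first elimination to them; the second block update then
factors the Schur complement.  The last equation is the relation that the next
stage needs. *)
Lemma block_update_apply_spec (n1 n2 : nat) (L : 'M[R]_n1) (L2 : 'M[R]_(n2, n1))
    (L1 : 'M[R]_n2) (A : 'M[R]_(n1 + n2, m)) :
  let K := block_mx L 0 L2 L1 in
  let B := block_update_B S L (usubmx A) in
  let T := block_update_T S L (usubmx A) in
  let A1 := block_apply_A L2 (dsubmx A) S B T in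
  let L' := block_update_L S L (usubmx A) in
  let L2' := block_apply_L L2 (dsubmx A) S B T in
  let L1' := block_update_L S L1 A1 in
  is_trig_mx K -> (forall i, 0 < K i i) ->
  posdefmx (K *m K^T + A *m S *m A^T) ->
  [/\ [&& block_update_defined S L (usubmx A), T \in unitmx
        & block_update_defined S L1 A1],
      is_chol (K *m K^T + A *m S *m A^T) (block_mx L' 0 L2' L1')
    & L1' *m L1'^T = L1 *m L1^T + A1 *m S *m A1^T].
Proof.
move=> K B T A1 L' L2' L1' trK posK pK.
have [_] := posdiag_trig_blocks trK posK.
rewrite block_mxKul block_mxKdr => trL posL trL1 posL1.
have pL : posdefmx (L *m L^T + usubmx A *m S *m (usubmx A)^T).
  have := pK; rewrite block_llt tr_col_mx mul_col_row -{1 2}[A]vsubmxK.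
  rewrite mul_col_mx tr_col_mx mul_col_row !add_block_mx addr0.
  exact: posdefmx_ulsub.
have [dfL chL elL] := block_update_spec trL posL pL.
have [uT _ _ _] := elL.
have WT : block_apply_W L2 (dsubmx A) S B T *m T = L2 + dsubmx A *m S *m B^T.
  by rewrite /block_apply_W mulmxKV.
have := eliminates_llt L1 elL WT; rewrite vsubmxK -/K -/L' => llt.
have uL' : L' \in unitmx by have [? ? _] := chL; apply: trig_unitmx.
have [dfL1 chL1 _] := block_update_spec trL1 posL1
  (posdefmx_schur uL' (eq_ind _ (@posdefmx _ _) pK _ llt)).
split; first by rewrite dfL uT.
  have [trL' posL' _] := chL.
  by rewrite llt; apply: is_chol_block chL1; split; first exact: trL'.
by have [] := chL1.
Qed.

End Reflection.

(** * The Riccati recursion *)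

Section Riccati.
Variables (R : rcfType) (N nu nx : nat) (c : nat -> nat).
Variables (Hl : nat -> 'M[R]_(nu + nx)) (QN : 'M[R]_nx).
Variables (F : nat -> 'M[R]_(nx, nu + nx)).
Variables (G : forall j, 'M[R]_(c j, nu + nx)) (GN : 'M[R]_(c N, nx)).

Section Factorization.
Variable Sigma : forall j, 'M[R]_(c j).
Hypothesis Hl_sym : forall j, (j < N)%N -> (Hl j)^T = Hl j.
Hypothesis QN_sym : QN^T = QN.
Hypothesis Sigma_sym : forall j, (j <= N)%N -> (Sigma j)^T = Sigma j.
Hypothesis wd : riccati_well_defined Hl QN F G GN Sigma.

Lemma riccati_LxxN :
  riccati_Lxx Hl QN F G GN Sigma N = chol (riccati_PN QN GN Sigma).
Proof. by rewrite /riccati_Lxx subnn. Qed.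

Lemma riccati_LxxE j : (j < N)%N ->
  riccati_Lxx Hl QN F G GN Sigma j
  = drsubmx (chol (riccati_H Hl QN F G GN Sigma j)).
Proof.
by move=> jN; rewrite /riccati_Lxx -(subnSK jN) /= subnSK // subKn // ltnW.
Qed.

Lemma riccati_PN_chol :
  is_chol (riccati_PN QN GN Sigma) (riccati_Lxx Hl QN F G GN Sigma N).
Proof.
rewrite riccati_LxxN; apply: posdefmx_is_chol; last by case: wd.
by rewrite linearD /= !trmx_mul trmxK Sigma_sym // QN_sym mulmxA.
Qed.

Lemma riccati_H_chol j : (j < N)%N ->
  is_chol (riccati_H Hl QN F G GN Sigma j)
    (block_mx (riccati_Luu Hl QN F G GN Sigma j) 0
       (riccati_Lxu Hl QN F G GN Sigma j) (riccati_Lxx Hl QN F G GN Sigma j)).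
Proof.
move=> jN; set H := riccati_H _ _ _ _ _ _ _.
have sH : H^T = H.
  rewrite /H /riccati_H /riccati_Hstep !linearD /= !trmx_mul !trmxK.
  by rewrite Sigma_sym 1?ltnW // Hl_sym // !mulmxA.
have chH : is_chol H (chol H).
  by apply: posdefmx_is_chol => //; case: wd => _; apply.
have [trH posH _] := chH; have [H_E _ _ _ _] := posdiag_trig_blocks trH posH.
by rewrite riccati_LxxE // /riccati_Luu /riccati_Lxu -/H -H_E.
Qed.

End Factorization.

Variables (Sigma Sigma' : forall j, 'M[R]_(c j)).
Hypothesis Hl_sym : forall j, (j < N)%N -> (Hl j)^T = Hl j.
Hypothesis QN_sym : QN^T = QN.
Hypothesis Sigma_sym : forall j, (j <= N)%N -> (Sigma j)^T = Sigma j.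
Hypothesis Sigma'_sym : forall j, (j <= N)%N -> (Sigma' j)^T = Sigma' j.
Hypothesis wd : riccati_well_defined Hl QN F G GN Sigma.
Hypothesis wd' : riccati_well_defined Hl QN F G GN Sigma'.

Local Notation Luu := (riccati_Luu Hl QN F G GN Sigma).
Local Notation Lxu := (riccati_Lxu Hl QN F G GN Sigma).
Local Notation Lxx := (riccati_Lxx Hl QN F G GN Sigma).
Local Notation Lxx' := (riccati_Lxx Hl QN F G GN Sigma').
Local Notation state_at := (update_state_at F G GN Sigma Sigma' Luu Lxu).

(** The induction invariant: [us_Phi] and [us_S] describe the change of the
matrix [Lxx Lxx^T] of stage [j] caused by replacing the penalties. *)
Definition state_tracks (j : nat) (st : update_state R nx) : Prop :=
  (us_S st)^T = us_S st /\
  Lxx' j *m (Lxx' j)^T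
  = Lxx j *m (Lxx j)^T + us_Phi st *m us_S st *m (us_Phi st)^T.

Lemma riccati_PN_update :
  riccati_PN QN GN Sigma'
  = riccati_PN QN GN Sigma + GN^T *m (Sigma' N - Sigma N) *m GN^T^T.
Proof.
rewrite /riccati_PN trmxK mulmxBr mulmxBl -addrA.
by rewrite [X in _ = _ + X]addrC subrK.
Qed.

Lemma update_state_atN :
  state_at N = UpdateState GN^T (Sigma' N - Sigma N).
Proof. by rewrite /update_state_at subnn. Qed.

Lemma update_state_atE j : (j < N)%N ->
  state_at j = step_state F G Sigma Sigma' Luu Lxu j (state_at j.+1).
Proof.
by move=> jN; rewrite /update_state_at -(subnSK jN) /= subnSK // subKn // ltnW.
Qed.

Lemma state_tracksN : state_tracks N (state_at N).
Proof.
rewrite update_state_atN; split.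
  by rewrite linearB /= Sigma_sym ?Sigma'_sym.
have [_ _ ->] := riccati_PN_chol QN_sym Sigma_sym wd.
have [_ _ ->] := riccati_PN_chol QN_sym Sigma'_sym wd'.
exact: riccati_PN_update.
Qed.

(** As [step_S] is block diagonal, [Upsilon S Upsilon^T] is the sum of the
propagated change [F^T Phi S Phi^T F] and of the local change
[G^T (Sigma' - Sigma) G]. *)
Lemma riccati_H_update j (st : update_state R nx) :
  state_tracks j.+1 st ->
  riccati_H Hl QN F G GN Sigma' j
  = riccati_H Hl QN F G GN Sigma j
    + step_Upsilon F G j st *m step_S Sigma Sigma' j st
      *m (step_Upsilon F G j st)^T.
Proof.
move=> [_ trk].
have YSY : step_Upsilon F G j st *m step_S Sigma Sigma' j st
      *m (step_Upsilon F G j st)^T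
    = (F j)^T *m (us_Phi st *m us_S st *m (us_Phi st)^T) *m F j
      + ((G j)^T *m Sigma' j *m G j - (G j)^T *m Sigma j *m G j).
  rewrite /step_Upsilon /step_S tr_row_mx mul_row_block !mulmx0 addr0 add0r.
  by rewrite mul_row_col trmx_mul !trmxK !mulmxA mulmxBr mulmxBl.
rewrite YSY /riccati_H /riccati_Hstep -!(mulmxA (F j)^T (_ j.+1)) trk.
rewrite mulmxDr mulmxDl [X in _ = _ + X]addrC [RHS]addrACA; congr (_ + _).
by rewrite -addrA [X in _ = _ + X]addrC subrK.
Qed.

Lemma update_stage j (st : update_state R nx) :
  (j < N)%N -> state_tracks j.+1 st ->
  [/\ step_defined F G Sigma Sigma' Luu Lxu Lxx j st,
      block_mx (step_Luu F G Sigma Sigma' Luu j st) 0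
        (step_Lxu F G Sigma Sigma' Luu Lxu j st)
        (step_Lxx F G Sigma Sigma' Luu Lxu Lxx j st)
      = chol (riccati_H Hl QN F G GN Sigma' j)
    & state_tracks j (step_state F G Sigma Sigma' Luu Lxu j st)].
Proof.
move=> jN trk; have [S_sym _] := trk.
have sS : (step_S Sigma Sigma' j st)^T = step_S Sigma Sigma' j st.
  rewrite tr_block_mx !trmx0 S_sym linearB /=.
  by rewrite Sigma_sym ?Sigma'_sym // ltnW.
have pH : posdefmx (riccati_H Hl QN F G GN Sigma' j) by case: wd' => _; apply.
have [trK posK KK] := riccati_H_chol Hl_sym Sigma_sym wd jN.
rewrite (riccati_H_update trk) -KK in pH.
have [df ch llt] := block_update_apply_spec sS trK posK pH.
rewrite KK -(riccati_H_update trk) in ch.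
split=> //; first by rewrite (chol_eq ch).
by split=> //=; rewrite riccati_LxxE // (chol_eq ch) block_mxKdr.
Qed.

Lemma update_tracks j : (j <= N)%N -> state_tracks j (state_at j).
Proof.
move=> jN; rewrite -(subKn jN); elim: (N - j)%N (leq_subr j N) => [|k IHk] kN.
  by rewrite subn0; apply: state_tracksN.
have lt : (N - k.+1 < N)%N by rewrite ltn_subrL (leq_ltn_trans _ kN).
rewrite update_state_atE //.
have [|//] := update_stage lt (st := state_at (N - k.+1).+1).
by rewrite subnSK //; apply: IHk; apply: ltnW.
Qed.

End Riccati.

Theorem mainTheorem1 (R : rcfType) (N nu nx : nat) (c : nat -> nat)
    (Hl : nat -> 'M[R]_(nu + nx)) (QN : 'M[R]_nx)
    (F : nat -> 'M[R]_(nx, nu + nx))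
    (G : forall j : nat, 'M[R]_(c j, nu + nx)) (GN : 'M[R]_(c N, nx))
    (Sigma Sigma' : forall j : nat, 'M[R]_(c j))
    (N_ge1 : (1 <= N)%N) (nu_ge1 : (1 <= nu)%N) (nx_ge1 : (1 <= nx)%N)
    (Hl_sym : forall j : nat, (j < N)%N -> (Hl j)^T = Hl j)
    (QN_sym : QN^T = QN)
    (Sigma_diag : forall j : nat, (j <= N)%N -> is_diag_mx (Sigma j))
    (Sigma_ge0 : forall j : nat, (j <= N)%N ->
       forall i : 'I_(c j), 0 <= Sigma j i i)
    (Sigma'_diag : forall j : nat, (j <= N)%N -> is_diag_mx (Sigma' j))
    (Sigma'_ge0 : forall j : nat, (j <= N)%N ->
       forall i : 'I_(c j), 0 <= Sigma' j i i)
    (wd : riccati_well_defined Hl QN F G GN Sigma)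
    (wd' : riccati_well_defined Hl QN F G GN Sigma') :
  let Luu := riccati_Luu Hl QN F G GN Sigma in
  let Lxu := riccati_Lxu Hl QN F G GN Sigma in
  let Lxx := riccati_Lxx Hl QN F G GN Sigma in
  let tLuu := update_Luu F G GN Sigma Sigma' Luu Lxu in
  let tLxu := update_Lxu F G GN Sigma Sigma' Luu Lxu in
  let tLxx := update_Lxx F G GN Sigma Sigma' Luu Lxu Lxx in
  [/\ update_well_defined F G GN Sigma Sigma' Luu Lxu Lxx,
      tLxx N = chol (riccati_PN QN GN Sigma')
    & forall j : nat, (j < N)%N ->
        block_mx (tLuu j) 0 (tLxu j) (tLxx j)
          = chol (riccati_H Hl QN F G GN Sigma' j)].
Proof.
move=> Luu Lxu Lxx tLuu tLxu tLxx.
have diag_sym n (D : 'M[R]_n) : is_diag_mx D -> D^T = D.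
  by case/diag_mxP => d ->; apply: tr_diag_mx.
have Sigma_sym j : (j <= N)%N -> (Sigma j)^T = Sigma j.
  by move/Sigma_diag/diag_sym.
have Sigma'_sym j : (j <= N)%N -> (Sigma' j)^T = Sigma' j.
  by move/Sigma'_diag/diag_sym.
have SN_sym : (Sigma' N - Sigma N)^T = Sigma' N - Sigma N.
  by rewrite linearB /= Sigma_sym ?Sigma'_sym.
have stage j (jN : (j < N)%N) := update_stage Hl_sym Sigma_sym Sigma'_sym wd wd' jN
  (update_tracks Hl_sym QN_sym Sigma_sym Sigma'_sym wd wd' jN).
have [trL posL LL] := riccati_PN_chol QN_sym Sigma_sym wd.
have PN' : riccati_PN QN GN Sigma'
    = Lxx N *m (Lxx N)^T + GN^T *m (Sigma' N - Sigma N) *m GN^T^T.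
  by rewrite LL; apply: riccati_PN_update.
have pPN' : posdefmx (riccati_PN QN GN Sigma') by case: wd'.
rewrite PN' in pPN'.
have [dfN chN _] := block_update_spec SN_sym trL posL pPN'.
split.
- by split=> // j /stage[].
- by rewrite /tLxx /update_Lxx ltnn PN' (chol_eq chN).
- by move=> j jN; rewrite /tLxx /update_Lxx jN; have [] := stage j jN.
Qed.
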